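(* Let $D$ be a conducive domain which is not a field. Then $D$ is $b$-Noetherian if and only if its integral closure is a DVR. In particular, a conducive integrally closed $b$-Noetherian domain which is not a field is a DVR.
   Context: Let $D$ be an integral domain with quotient field $K$. An overring of $D$ is a ring $T$ with $D\subseteq T\subseteq K$; a valuation overring is an overring which is a valuation domain. For each nonzero $D$-submodule $E$ of $K$ set $E^b:=\bigcap\{EV \mid V \text{ valuation overring of } D\}$. A quasi-$b$-ideal of $D$ is a nonzero ideal $I$ of $D$ with $I^b\cap D=I$. $D$ is $b$-Noetherian if the ascending chain condition holds on quasi-$b$-ideals of $D$; equivalently, for each nonzero ideal $I$ of $D$ there is a finitely generated ideal $F\subseteq I$ with $F^b=I^b$. $D$ is conducive if $(D:T):=\{x\in K\mid xT\subseteq D\}\neq(0)$ for every overring $T\neq K$ of $D$. The integral closure is taken in $K$. *)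

(* Defs.v *)
(* MathComp, with the Prop-valued sets of mathcomp-classical. *)
From mathcomp Require Export all_boot all_order all_algebra fraction.
From mathcomp Require Export boolp classical_sets.

Set Implicit Arguments.
Unset Strict Implicit.
Unset Printing Implicit Defensive.

Import Order.TTheory GRing.Theory Num.Theory.
Local Open Scope classical_set_scope.
Local Open Scope ring_scope.

(* The quotient field of D is {fraction D}. Overrings, D-submodules and ideals
   are all Prop-valued subsets of it, and D itself is identified with the image
   [base D] of the canonical embedding. *)
Section Overrings.
Variable D : idomainType.
Local Notation K := {fraction D}.
Local Notation "x %:F" := (@FracField.tofrac D x).

Definition base : set K := range (@FracField.tofrac D).

Definition overring (T : set K) : Prop :=
  base `<=` T /\ GRing.subring_closed [in T].

(* As D is contained in V, the quotient field of V is all of K; V = K is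
   allowed. *)
Definition valuation_overring (V : set K) : Prop :=
  overring V /\ forall x : K, x != 0 -> V x \/ V x^-1.

Definition submodule (E : set K) : Prop :=
  E 0 /\ forall (d : D) (x y : K), E x -> E y -> E (d%:F * x + y).

Definition prod_set (E F : set K) : set K :=
  [set x | exists (n : nat) (e f : 'I_n -> K),
     [/\ forall i, E (e i), forall i, F (f i) & x = \sum_(i < n) e i * f i]].

Definition b_closure (E : set K) : set K :=
  \bigcap_(V in valuation_overring) prod_set E V.

Definition nonzero_ideal (I : set K) : Prop :=
  [/\ submodule I, I `<=` base & I <> [set 0]].

Definition quasi_b_ideal (I : set K) : Prop :=
  nonzero_ideal I /\ b_closure I `&` base = I.

Definition b_noetherian : Prop :=
  forall I : nat -> set K,
    (forall n, quasi_b_ideal (I n)) -> (forall n, I n `<=` I n.+1) ->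
    exists N, forall n, (N <= n)%N -> I n = I N.

Definition conductor (T : set K) : set K :=
  [set x | forall t, T t -> base (x * t)].

Definition conducive : Prop :=
  forall T : set K, overring T -> T <> setT -> conductor T <> [set 0].

Definition integral_closure : set K :=
  [set x | integralOver (@FracField.tofrac D) x].

Definition integrally_closed : Prop := integral_closure = base.

End Overrings.

Arguments base D : clear implicits.
Arguments integral_closure D : clear implicits.

(* [v] is a normalized discrete valuation of the field K: a surjective
   homomorphism from the multiplicative group of K onto the integers, with the
   ultrametric inequality. The value [v 0] is junk (it should be +oo). *)
Definition discrete_valuation (K : fieldType) (v : K -> int) : Prop :=
  [/\ forall x y : K, x != 0 -> y != 0 -> v (x * y) = v x + v y,
      forall x y : K, x != 0 -> y != 0 -> x + y != 0 ->
        Num.min (v x) (v y) <= v (x + y)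
    & forall n : int, exists2 x : K, x != 0 & v x = n].

(* The subset T of K is a DVR with quotient field K; fields are excluded by the
   surjectivity of the valuation. *)
Definition is_DVR (K : fieldType) (T : set K) : Prop :=
  exists2 v : K -> int, discrete_valuation v &
    T = [set x | x = 0 \/ (x != 0 /\ 0 <= v x)].

(* Main.v *)
From HB Require Import structures.
Require Import Defs.
From mathcomp Require Import mxpoly ring zify.

Set Implicit Arguments.
Unset Strict Implicit.
Unset Printing Implicit Defensive.

Import Order.TTheory GRing.Theory Num.Theory.
Local Open Scope classical_set_scope.
Local Open Scope ring_scope.

(** Write D' for the integral closure of D.

    If D' is a DVR with valuation v, then D' lies in every valuation overring,
    so D' is the smallest one.  Hence an element x of D lies in a
    quasi-b-ideal I as soon as v i <= v x for some nonzero i in I, and a chain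
    of such ideals is stationary from the first ideal that contains an element
    of least value in the union ([integral_closure_DVR_b_noetherian]).

    Conversely, let D be conducive and b-Noetherian, and let V <> K be a
    valuation overring.  Choose c <> 0 with c V inside D.  For x in V, c x V is
    an ideal of D, and it is a quasi-b-ideal because V is one of the rings that
    define the b-closure ([principal_quasi_b_ideal]).  So the chain condition
    on D gives the chain condition on principal ideals of V, which forces a
    valuation ring to be a DVR ([accp_valuation_DVR]).  If W <> K is another
    valuation overring, it is a DVR as well, and c x^n lies in D, hence in W,
    for all x in V and all n; as the W-value of c x^n stays nonnegative, so is
    that of x ([DVR_completely_integrally_closed]).  Thus V lies inside W: there
    is at most one valuation overring besides K.

    What remains is that D' is the intersection of the valuation overrings:
    an element x that is not integral over D is avoided by some valuation
    overring ([exists_valuation_ring_avoiding]).  For x the inverse of a nonunit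
    of D this gives the existence of V; for x in V it gives V = D'. *)

(** * Adjoining an element to a subring of a field *)

Section Adjoin.
Variables (R : comNzRingType) (K : fieldType) (f : {rmorphism R -> K}).
Local Notation "p ^f" := (map_poly f p).

(** This is f(R)[u]. Describing subrings of K as images of ring morphisms makes
    the theory of [integralOver] available for each of them. *)
Definition adjoin (u : K) : set K := range (fun p : {poly R} => p^f.[u]).

Lemma horner_rev_poly (p : {poly R}) (n : nat) (z : K) :
  z != 0 -> (size p <= n)%N ->
  (\poly_(i < n) p`_(n.-1 - i))^f.[z] = p^f.[z^-1] * z ^+ n.-1.
Proof.
move=> z0 sp.
have -> : p^f.[z^-1] = \sum_(i < n) f p`_i * z^-1 ^+ i.
  rewrite (@horner_coef_wide _ n) ?(leq_trans (size_poly _ _)) //.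
  by apply: eq_bigr => i _; rewrite coef_map.
rewrite (@horner_coef_wide _ n); last first.
  by rewrite (leq_trans (size_poly _ _)) ?size_poly.
rewrite mulr_suml (reindex_inj rev_ord_inj) /=; apply: eq_bigr => i _.
rewrite coef_map coef_poly /= (_ : (n - i.+1 < n)%N); last by case: i => /=; lia.
have ltin := ltn_ord i.
rewrite (_ : (n.-1 - (n - i.+1))%N = i); last by lia.
rewrite (_ : n.-1 = (n - i.+1) + i)%N; last by lia.
by rewrite -mulrA exprD exprVn [_^-1 * _]mulrCA mulVf ?mulr1 // expf_neq0.
Qed.

(** Multiplying z = p(1/z) by a power of z gives a monic equation for z, and
    dividing a monic equation of degree n by z^(n-1) gives such a p.  Integrality
    thus becomes a membership, which can be tested inside overrings. *)
Lemma integral_adjoinV (z : K) : z != 0 -> integralOver f z <-> adjoin z^-1 z.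
Proof.
move=> z0; split=> [[q qm /rootP qz]|[p _ pz]].
  have sq : (1 < size q)%N.
    rewrite ltnNge; apply/negP => /size1_polyC qC.
    move: qm qz; rewrite qC monicE lead_coefC => /eqP ->.
    by rewrite rmorph1 hornerC => /eqP; rewrite oner_eq0.
  pose n := (size q).-1.
  have nE : n = n.-1.+1 by rewrite /n; case: (size q) sq => [|[|]].
  pose r := q - 'X^n.
  have sr : (size r <= n)%N.
    apply/leq_sizeP => j; rewrite leq_eqVlt coefB coefXn => /orP[/eqP<-|nj].
      by rewrite eqxx -/(lead_coef q) (monicP qm) subrr.
    rewrite gtn_eqF // subr0; apply: nth_default.
    by move: nj; rewrite /n; case: (size q) sq.
  have rz : r^f.[z] = - z ^+ n.
    by rewrite rmorphB /= map_polyXn hornerD hornerN qz hornerXn add0r.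
  exists (- \poly_(i < n) r`_(n.-1 - i)) => //.
  have /= := horner_rev_poly (n := n) (p := r) (z := z^-1).
  rewrite invr_eq0 invrK rz => /(_ z0 sr) E.
  rewrite rmorphN hornerN E {1}nE mulNr opprK exprS -mulrA exprVn mulfV ?mulr1 //.
  exact: expf_neq0.
pose n := size p.
have n0 : (0 < n)%N.
  rewrite lt0n size_poly_eq0; apply: contraNneq z0 => p0.
  by rewrite -pz p0 rmorph0 horner0.
pose r := - \poly_(i < n) p`_(n.-1 - i).
have sr : (size r < size ('X^n : {poly R}))%N.
  by rewrite size_polyXn ltnS size_polyN size_poly.
exists ('X^n + r).
  by rewrite monicE lead_coefDl // -monicE monicXn.
apply/rootP; rewrite rmorphD /= map_polyXn hornerD hornerXn rmorphN hornerN.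
rewrite horner_rev_poly // pz -exprS prednK //.
exact: subrr.
Qed.

Lemma integral_horner_map (p : {poly R}) (u : K) :
  integralOver f u -> integralOver f p^f.[u].
Proof.
move=> iu; apply: integral_horner => //; apply/integral_poly => i.
by rewrite coef_map; apply: integral_id.
Qed.

Lemma adjoin_subring (u : K) : GRing.subring_closed [in adjoin u].
Proof.
split=> [|_ _ /set_mem[p _ <-] /set_mem[q _ <-]|
          _ _ /set_mem[p _ <-] /set_mem[q _ <-]]; apply/mem_set.
- by exists 1; rewrite // rmorph1 hornerC.
- by exists (p - q); rewrite // rmorphB hornerD hornerN.
- by exists (p * q); rewrite // rmorphM hornerM.
Qed.

Lemma range_sub_adjoin (u : K) : range f `<=` adjoin u.
Proof. by move=> _ [a _ <-]; exists a%:P; rewrite // map_polyC hornerC. Qed.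

Lemma mem_adjoin (u : K) : adjoin u u.
Proof. by exists 'X; rewrite // map_polyX hornerX. Qed.

Lemma adjoin_range (u : K) : range f u -> adjoin u `<=` range f.
Proof. by move=> [a _ <-] _ [p _ <-]; exists p.[a]; rewrite ?horner_map. Qed.

(** Let A = f(R).  As 1/x is in A and x is not, x is not integral over A.
    For b in A the inverse of s = x - b is in A: otherwise maximality puts x,
    hence s, into A[1/s], so s and then x would be integral over A.
    If neither u nor 1/u were in A, then x = c + q(1/u)/u for some c in A and
    some polynomial q over A; dividing by x - c gives u = q(1/u)/(x - c), an
    element of A[1/u].  So u is integral over A, and so is x, since x is in
    A[u]: a contradiction. *)
Lemma maximal_avoiding_valuation (x : K) :
  x != 0 -> range f x^-1 -> ~ range f x ->
  (forall u, ~ range f u -> adjoin u x) ->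
  forall u, u != 0 -> range f u \/ range f u^-1.
Proof.
move=> x0 xV xN max u u0.
have xNint : ~ integralOver f x.
  by move=> /integral_adjoinV-/(_ x0) /(adjoin_range xV).
have inv b : range f (x - f b)^-1.
  apply: contrapT => /max [p _ px]; apply: xNint.
  have s0 : x - f b != 0.
    by apply: contra_notN xN => /eqP/subr0_eq ->; exists b.
  rewrite -[x](subrK (f b)); apply: integral_add; last exact: integral_id.
  apply/(integral_adjoinV s0); exists (p - b%:P) => //.
  by rewrite rmorphB /= map_polyC hornerD hornerN hornerC px.
apply: contrapT => /not_orP[/max uN /max [q _]].
elim/poly_ind: q => [|q c _] qx.
  by case: xN; exists 0; rewrite // -qx !rmorph0 horner0.
have [r _ rE] := inv c.
have xc0 : x - f c != 0 by apply: contra_notN xN => /eqP/subr0_eq ->; exists c.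
move: qx; rewrite rmorphD rmorphM /= map_polyX map_polyC hornerMXaddC /= => qx.
have iu : integralOver f u.
  apply/(integral_adjoinV u0); exists (r *: q) => //.
  rewrite map_polyZ hornerZ rE; apply: (mulfI xc0).
  by rewrite mulVKf // -qx addrK mulfVK.
by case: uN => p _ px; apply: xNint; rewrite -px; apply: integral_horner_map.
Qed.

End Adjoin.

(** * Existence of valuation rings *)

Section Subring.
Variables (K : fieldType) (A : set K).
Hypothesis A_subring : GRing.subring_closed [in A].

Let S : {pred K} := [in A].
HB.instance Definition _ := GRing.isSubringClosed.Build K S A_subring.
Let T := {x : K | x \in S}.
HB.instance Definition _ := [isSub of T for sval].
HB.instance Definition _ := [Choice of T by <:].
HB.instance Definition _ := [SubChoice_isSubComNzRing of T by <:].

(** The ring structure on the subset is put on a subtype; only the resulting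
    morphism is exported. *)
Lemma subring_range :
  exists (R : comNzRingType) (f : {rmorphism R -> K}), range f = A.
Proof.
exists T, (val : {rmorphism T -> K}); apply/seteqP; split=> [_ [[x Ax] _ <-]|x Ax].
  exact: set_mem.
by exists (Sub x (mem_set Ax) : T).
Qed.

End Subring.

Lemma maximal_subring_avoiding (K : fieldType) (B : set K) (x : K) :
  GRing.subring_closed [in B] -> ~ B x ->
  exists A : set K, [/\ GRing.subring_closed [in A], B `<=` A, ~ A x &
    forall C : set K, GRing.subring_closed [in C] -> A `<=` C -> ~ C x -> C = A].
Proof.
move=> Bs Bx.
pose good (A : set K) := [/\ GRing.subring_closed [in A], B `<=` A & ~ A x].
have goodB : good B by split.
(* The empty set is added because the union of the empty chain has to qualify. *)
have [] := @Zorn_bigcup _ [set A | A = set0 \/ good A].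
  move=> F FP Ftot.
  have [[A0 FA0 gA0]|noA] := pselect (exists2 A, F A & good A); last first.
    left; apply/seteqP; split=> // z [A FA Az].
    case: (FP A FA) => [A0|gA]; first by rewrite A0 in Az.
    by case: noA; exists A.
  right; split=> [|z Bz|[A FA Ax]]; last 2 first.
  - by exists A0 => //; case: gA0 => _ + _; apply.
  - by case: (FP A FA) => [A_0|[_ _]//]; rewrite A_0 in Ax.
  have two y z : (\bigcup_(X in F) X) y -> (\bigcup_(X in F) X) z ->
      exists A, [/\ F A, GRing.subring_closed [in A], A y & A z].
    have sub A t : F A -> A t -> GRing.subring_closed [in A].
      by move=> /FP[->//|[]].
    move=> [X FX Xy] [Y FY Yz]; case: (Ftot X Y FX FY) => XY.
      by exists Y; split=> //; [apply: sub Yz|apply: XY].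
    by exists X; split=> //; [apply: sub Xy|apply: XY].
  split=> [|y z /set_mem yU /set_mem zU|y z /set_mem yU /set_mem zU]; apply/mem_set.
  - by exists A0 => //; case: gA0 => -[/set_mem].
  - have [A [FA [_ h _] Ay Az]] := two y z yU zU.
    by exists A => //; apply/set_mem/h; apply/mem_set.
  - have [A [FA [_ _ h] Ay Az]] := two y z yU zU.
    by exists A => //; apply/set_mem/h; apply/mem_set.
move=> A [[A0|[As BA Ax]] max].
  exfalso; apply: (max B); last by right.
  rewrite A0; split=> // B0.
  by apply: (B0 1); case: Bs => /set_mem.
exists A; split=> // C Cs AC Cx; apply/seteqP; split=> //.
apply: contrapT => CA; apply: (max C); first by split.
by right; split=> // z Bz; apply/AC/BA.
Qed.

(** Since x is not integral over f(R), it is not in f(R)[1/x]; a subring that is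
    maximal among those containing f(R)[1/x] but not x is a valuation ring. *)
Lemma exists_valuation_ring_avoiding (R : comNzRingType) (K : fieldType)
    (f : {rmorphism R -> K}) (x : K) :
  ~ integralOver f x ->
  exists V : set K, [/\ GRing.subring_closed [in V], range f `<=` V, ~ V x &
    forall u, u != 0 -> V u \/ V u^-1].
Proof.
move=> xN.
have x0 : x != 0 by apply: contra_notN xN => /eqP ->; apply: integral0.
have xV : ~ adjoin f x^-1 x by move/(integral_adjoinV f x0).
have [A [As BA Ax max]] := maximal_subring_avoiding (adjoin_subring f x^-1) xV.
have [S [g gA]] := subring_range As; exists A; split=> //.
  by move=> z fz; apply/BA/range_sub_adjoin.
rewrite -gA; apply: (maximal_avoiding_valuation (x := x)) => //.
- by rewrite gA; apply/BA/mem_adjoin.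
- by rewrite gA.
move=> u; rewrite gA => Au; apply: contrapT => ux; apply: Au.
rewrite -(max _ (adjoin_subring g u) _ ux); first exact: mem_adjoin.
by rewrite -gA; apply: range_sub_adjoin.
Qed.
(** * Discrete valuation rings *)

(** A valuation ring V of K, other than K, with the ascending chain condition on
    principal ideals; x V <= y V is expressed by x / y being in V. *)
Section ValuationRing.
Variables (K : fieldType) (V : set K).
Hypothesis V_subring : GRing.subring_closed [in V].
Hypothesis V_val : forall u, u != 0 -> V u \/ V u^-1.

Let V1 : V 1.
Proof. by case: V_subring => /set_mem. Qed.

Let VB x y : V x -> V y -> V (x - y).
Proof.
by case: V_subring => _ h _ /mem_set xV /mem_set yV; apply/set_mem/h.
Qed.

Let VM x y : V x -> V y -> V (x * y).
Proof.
by case: V_subring => _ _ h /mem_set xV /mem_set yV; apply/set_mem/h.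
Qed.

Let VD x y : V x -> V y -> V (x + y).
Proof.
move=> xV yV; rewrite -[y]opprK; apply: VB => //.
by rewrite -sub0r; apply: VB => //; rewrite -(subrr 1); apply: VB.
Qed.

Let VX x n : V x -> V (x ^+ n).
Proof. by move=> xV; elim: n => [//|n IH]; rewrite exprS; apply: VM. Qed.

Hypothesis V_neqT : V <> setT.
Hypothesis V_accp : forall x : nat -> K,
  (forall n, x n != 0 /\ V (x n)) -> (forall n, V (x n / x n.+1)) ->
  exists n, V (x n.+1 / x n).

Let nonunit (y : K) := [/\ y != 0, V y & ~ V y^-1].

Let exists_nonunit : exists y, nonunit y.
Proof.
apply: contrapT => no; apply: V_neqT; apply/seteqP; split=> // z _.
apply: contrapT => zV; apply: no; exists z^-1.
have z0 : z != 0 by apply: contra_notN zV => /eqP ->; rewrite -(subrr 1); apply: VB.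
by split; rewrite ?invr_eq0 ?invrK //; case: (V_val z0).
Qed.

(** Otherwise every nonunit t has a nonunit y outside t V; as V is a valuation
    ring, t V is strictly contained in y V, and iterating gives an infinite
    strictly ascending chain of principal ideals. *)
Let exists_uniformizer :
  exists2 t, nonunit t & forall y, nonunit y -> V (y / t).
Proof.
apply: contrapT => no.
have /choice[g gP] : forall t, exists y, nonunit t -> nonunit y /\ ~ V (y / t).
  move=> t; apply: contrapT => noy; apply: no; exists t.
    by apply: contrapT => tN; apply: noy; exists 0.
  by move=> y yN; apply: contrapT => ytV; apply: noy; exists y.
have [y0 y0N] := exists_nonunit.
pose x n := iter n g y0.
have xN n : nonunit (x n) by elim: n => //= n /gP[].
have xS n : ~ V (x n.+1 / x n) by case: (gP _ (xN n)).
have [n|n|n /xS //] := V_accp (x := x); first by case: (xN n).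
have [x0 _ _] := xN n; have [x1 _ _] := xN n.+1.
have q0 : x n.+1 / x n != 0 by rewrite mulf_neq0 ?invr_eq0.
by case: (V_val q0) => [/xS//|]; rewrite invf_div.
Qed.

Section Uniformizer.
Variable t : K.
Hypothesis tN : nonunit t.
Hypothesis t_unif : forall y, nonunit y -> V (y / t).

Let t0 : t != 0. Proof. by case: tN. Qed.

Let VXz (k : int) : V (t ^ k) <-> 0 <= k.
Proof.
case: k => [n|n]; first by split=> // _; apply: VX; case: tN.
split=> // tV; case: tN => _ Vt []; rewrite (_ : t^-1 = t ^ Negz n * t ^+ n).
  by apply: VM => //; apply: VX.
by rewrite NegzE -invr_expz exprSz invfM -mulrA mulVf ?mulr1 // expf_neq0.
Qed.

(** Otherwise all x / t^n are nonunits of V, by induction, and they generate a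
    strictly ascending chain of principal ideals. *)
Let unit_part_nat x : x != 0 -> V x ->
  exists n : nat, V (x / t ^+ n) /\ V (t ^+ n / x).
Proof.
move=> x0 xV; apply: contrapT => no.
have yV n : V (x / t ^+ n).
  elim: n => [|n IH]; first by rewrite divr1.
  rewrite exprSr invfM mulrA; apply: t_unif; split=> //.
    by rewrite mulf_neq0 // invr_eq0 expf_neq0.
  by rewrite invf_div => h; apply: no; exists n.
have [n|n|n] := V_accp (x := fun n => x / t ^+ n).
- by rewrite mulf_neq0 // invr_eq0 expf_neq0.
- rewrite (_ : _ / _ = t); first by case: tN.
  by rewrite exprS; field; rewrite x0 t0 expf_neq0.
rewrite (_ : _ / _ = t^-1); first by case: tN.
by rewrite exprS; field; rewrite x0 t0 expf_neq0.
Qed.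

Let unit_part x : exists k : int, x != 0 ->
  V (x * t ^ (- k)) /\ V (x^-1 * t ^ k).
Proof.
have [->|x0] := eqVneq x 0; first by exists 0.
case: (V_val x0) => [xV|xV].
  have [n [h1 h2]] := unit_part_nat x0 xV.
  by exists n => _; rewrite -invr_expz [x^-1 * _]mulrC.
have [|n [h1 h2]] := unit_part_nat _ xV; first by rewrite invr_eq0.
exists (- n%:Z) => _; rewrite opprK -invr_expz; split=> //.
by move: h2; rewrite invrK mulrC.
Qed.

(** The valuation sends x to the k such that x / t^k is a unit of V; all its
    properties follow from x t^(-m) being in V exactly when m <= v x. *)
Lemma uniformizer_DVR : is_DVR V.
Proof.
have [v vP] := choice unit_part.
have vM x y m k : V (x * t ^ m) -> V (y * t ^ k) -> V (x * y * t ^ (m + k)).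
  by move=> h1 h2; rewrite expfzDr // mulrACA; apply: VM.
have vD x m k : V (x * t ^ m) -> m <= k -> V (x * t ^ k).
  move=> h1 mk; rewrite -(subrK m k) addrC expfzDr // mulrA; apply: VM => //.
  by apply/VXz; rewrite subr_ge0.
have le x m : x != 0 -> V (x * t ^ (- m)) <-> m <= v x.
  move=> x0; have [h1 h2] := vP x x0; split=> [xV|mv].
    have := vM _ _ _ _ xV h2; rewrite mulfV // mul1r => /VXz.
    by rewrite addrC subr_ge0.
  by apply: vD h1 _; rewrite lerN2.
have eqv x m : x != 0 -> V (x * t ^ (- m)) -> V (x^-1 * t ^ m) -> v x = m.
  move=> x0 /le mv h; apply/eqP; rewrite eq_le mv // andbT.
  have [h1 _] := vP x x0; have := vM _ _ _ _ h1 h.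
  by rewrite mulfV // mul1r => /VXz; rewrite addrC subr_ge0.
exists v; first split.
- move=> x y x0 y0; have [h1 h2] := vP x x0; have [h3 h4] := vP y y0.
  apply: eqv; first by rewrite mulf_neq0.
    by rewrite opprD; apply: vM.
  by rewrite invfM; apply: vM.
- move=> x y x0 y0 xy0; apply/le => //; rewrite mulrDl.
  by apply: VD; apply/le => //; rewrite ge_min lexx ?orbT.
- move=> n; exists (t ^ n); first by rewrite expfz_eq0 negb_and t0 orbT.
  apply: eqv; first by rewrite expfz_eq0 negb_and t0 orbT.
    by rewrite -expfzDr // subrr.
  by rewrite mulVf // expfz_eq0 negb_and t0 orbT.
apply/seteqP; split=> [x xV|x [->|[x0]]] /=.
- have [->|x0] := eqVneq x 0; [by left|right; split=> //].
  by apply/le => //; rewrite oppr0 mulr1.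
- by rewrite -(subrr 1); apply: VB.
- by move/le; rewrite oppr0 mulr1; apply.
Qed.

End Uniformizer.

Lemma accp_valuation_DVR : is_DVR V.
Proof. by have [t tN tu] := exists_uniformizer; apply: (uniformizer_DVR tN). Qed.

End ValuationRing.

Section DiscreteValuation.
Variables (K : fieldType) (v : K -> int).
Hypothesis v_dv : discrete_valuation v.

Lemma valM x y : x != 0 -> y != 0 -> v (x * y) = v x + v y.
Proof. by case: v_dv => h _ _; apply: h. Qed.

Lemma val1 : v 1 = 0.
Proof. by apply: (addrI (v 1)); rewrite -valM ?oner_neq0 // mul1r addr0. Qed.

Lemma valV x : x != 0 -> v x^-1 = - v x.
Proof.
move=> x0; apply: (addrI (v x)); rewrite -valM ?invr_eq0 //.
by rewrite mulfV // val1 subrr.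
Qed.

Lemma valX x n : x != 0 -> v (x ^+ n) = v x *+ n.
Proof.
move=> x0; elim: n => [|n IH]; first by rewrite val1.
by rewrite exprS valM ?expf_neq0 // IH mulrS.
Qed.

End DiscreteValuation.

Lemma DVR_valuation (K : fieldType) (W : set K) : is_DVR W ->
  forall u, u != 0 -> W u \/ W u^-1.
Proof.
move=> [v vdv ->] u u0 /=; rewrite invr_eq0 u0 valV // oppr_ge0.
by case/orP: (le_total 0 (v u)) => h; [left|right]; right.
Qed.

(** If v x < 0 then v (c x^n) = v c + n v x is negative for n = |v c| + 1. *)
Lemma DVR_completely_integrally_closed (K : fieldType) (W : set K) (c x : K) :
  is_DVR W -> c != 0 -> (forall n, W (c * x ^+ n)) -> W x.
Proof.
move=> [v vdv ->] c0 cx /=.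
have [->|x0] := eqVneq x 0; [by left|right; split=> //].
rewrite leNgt; apply/negP => vx.
have := cx `|v c|.+1 => -[/eqP|[_]].
  by rewrite mulf_eq0 (negPf c0) expf_eq0 (negPf x0) andbF.
rewrite valM ?expf_neq0 // valX //.
have : v x *+ `|v c|.+1 <= - (`|v c|.+1)%:Z.
  by rewrite -mulr_natr natz; nia.
lia.
Qed.
(** * Conducive domains *)

Section Overrings.
Variable D : idomainType.
Local Notation K := {fraction D}.
Local Notation tofrac := (@FracField.tofrac D).

Lemma integral_closure_overring : overring (integral_closure D).
Proof.
split=> [_ [d _ <-]|]; first exact: integral_id.
split=> [|x y /set_mem xi /set_mem yi|x y /set_mem xi /set_mem yi]; apply/mem_set.
- exact: integral1.
- exact: integral_sub.
- exact: integral_mul.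
Qed.

Lemma base_overring (T : set K) d : overring T -> T (tofrac d).
Proof. by move=> [h _]; apply: h; exists d. Qed.

Lemma overring0 (T : set K) : overring T -> T 0.
Proof. by rewrite -(rmorph0 tofrac); apply: base_overring. Qed.

Lemma overringM (T : set K) x y : overring T -> T x -> T y -> T (x * y).
Proof. by move=> [_ [_ _ h]] /mem_set Tx /mem_set Ty; apply/set_mem/h. Qed.

Lemma overringD (T : set K) x y : overring T -> T x -> T y -> T (x + y).
Proof.
move=> [_ Ts] /mem_set Tx /mem_set Ty; apply/set_mem.
by have [_ h] := GRing.zmod_closedD (GRing.subring_closedB Ts); apply: h.
Qed.

Lemma overring_sum (T : set K) n (x : 'I_n -> K) :
  overring T -> (forall i, T (x i)) -> T (\sum_i x i).
Proof.
move=> Tov xT; elim/big_ind: _ => //; first exact: overring0.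
by move=> y z; apply: overringD.
Qed.

Lemma overring1 (T : set K) : overring T -> T 1.
Proof. by move=> [_ [/set_mem]]. Qed.

Lemma overring_horner (T : set K) p u :
  overring T -> T u -> T (map_poly tofrac p).[u].
Proof.
move=> Tov Tu; elim/poly_ind: p => [|p d IH].
  by rewrite rmorph0 horner0; apply: overring0.
rewrite rmorphD rmorphM /= map_polyX map_polyC hornerMXaddC.
apply: overringD => //; first exact: overringM.
exact: base_overring.
Qed.

(** If x is integral but 1/x is in V, then x is in D[1/x], which lies in V. *)
Lemma integral_closure_sub_valuation_overring V :
  valuation_overring V -> integral_closure D `<=` V.
Proof.
move=> [Vov Vval] x xi; have [->|x0] := eqVneq x 0; first exact: overring0.
case: (Vval x x0) => // xV.
have [p _ <-] := (integral_adjoinV tofrac x0).1 xi.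
exact: overring_horner.
Qed.

Lemma valuation_overring_avoiding x : ~ integral_closure D x ->
  exists2 V, valuation_overring V & ~ V x.
Proof.
by move=> /exists_valuation_ring_avoiding[V [Vs DV Vx Vval]]; exists V.
Qed.

(** If 1/d is integral over D, then it is in D[d] = D. *)
Lemma inv_nonunit_not_integral (d : D) :
  d != 0 -> d \isn't a GRing.unit -> ~ integral_closure D (tofrac d)^-1.
Proof.
move=> d0 dN.
have fd0 : tofrac d != 0 by rewrite tofrac_eq0.
have fdV0 : (tofrac d)^-1 != 0 by rewrite invr_eq0.
move=> /(integral_adjoinV _ fdV0); rewrite invrK => -[p _].
rewrite horner_map /= => pd; move/negP: dN; apply; apply/unitrPr; exists p.[d].
by apply/eqP; rewrite -tofrac_eq rmorphM /= pd mulfV // rmorph1.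
Qed.

Lemma sub_b_closure (E : set K) : E `<=` b_closure E.
Proof.
move=> x Ex V [Vov _]; exists 1%N, (fun=> x), (fun=> 1).
by split=> //; [move=> _; apply: overring1|rewrite big_ord1 mulr1].
Qed.

(** The b-closure of I = c x V is contained in I V = I. *)
Lemma principal_quasi_b_ideal (V : set K) (c x : K) :
  valuation_overring V -> conductor V c -> c != 0 -> V x -> x != 0 ->
  quasi_b_ideal ([set c * x * y | y in V] : set K).
Proof.
move=> Vval cV c0 Vx x0; have [Vov _] := Vval.
have sub : [set c * x * y | y in V] `<=` base D.
  by move=> _ [y Vy <-]; rewrite -mulrA; apply: cV; apply: overringM.
split; first split=> //.
- split; first by exists 0; rewrite ?mulr0 //; apply: overring0.
  move=> d _ _ [y Vy <-] [z Vz <-]; exists (tofrac d * y + z).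
    apply: overringD => //; apply: overringM => //.
    exact: base_overring.
  by rewrite mulrDr mulrCA.
- move=> I0; have : [set c * x * y | y in V] (c * x * 1).
    by exists 1 => //; apply: overring1.
  by rewrite I0 mulr1 => /eqP; rewrite mulf_eq0 (negPf c0) (negPf x0).
apply/seteqP; split=> [z [/(_ V Vval) [n [e [f [eI fV ->]]]] _]|z Iz]; last first.
  by split; [apply: sub_b_closure|apply: sub].
have /choice[g gP] : forall i, exists y, V y /\ c * x * y = e i.
  by move=> i; have [y Vy <-] := eI i; exists y.
exists (\sum_i g i * f i).
  by apply: overring_sum => // i; apply: overringM => //; case: (gP i).
by rewrite mulr_sumr; apply: eq_bigr => i _; rewrite mulrA; case: (gP i) => _ ->.
Qed.

Lemma conductor_neq0 (V : set K) : conductor V <> [set 0] ->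
  exists2 c, c != 0 & conductor V c.
Proof.
move=> cN; apply: contrapT => no.
apply: cN; apply/seteqP; split=> [c cV|c ->] /=.
  by apply: contrapT => /eqP c0; apply: no; exists c.
by move=> t _; exists 0; rewrite ?rmorph0 ?mul0r.
Qed.

(** A chain of principal ideals x_n V becomes, after multiplication by c, a chain
    of quasi-b-ideals of D. *)
Lemma valuation_overring_DVR (V : set K) : conducive D -> b_noetherian D ->
  valuation_overring V -> V <> setT -> is_DVR V.
Proof.
move=> Dc Db Vval VT; have [Vov Vv] := Vval.
have [c c0 cV] := conductor_neq0 (Dc V Vov VT).
apply: accp_valuation_DVR => //; first by case: Vov.
move=> x xV xdiv.
pose I n : set K := [set c * x n * y | y in V].
have [N IN] : exists N, forall n, (N <= n)%N -> I n = I N.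
  apply: Db => n.
    by have [x0 Vx] := xV n; apply: principal_quasi_b_ideal.
  move=> _ [y Vy <-]; exists (x n / x n.+1 * y); first exact: overringM.
  have [x1 _] := xV n.+1.
  by rewrite !mulrA; congr (_ * _); rewrite mulrAC mulfK // mulrAC.
have [x1 Vx1] := xV N.+1; have [xN _] := xV N.
have : I N (c * x N.+1 * 1).
  by rewrite -(IN N.+1 (leqnSn N)); exists 1 => //; apply: overring1.
move=> [y Vy]; rewrite mulr1 -mulrA => /(mulfI c0) yE.
by exists N; rewrite -yE mulrC mulKf.
Qed.

Lemma proper_overring_sub_DVR (V W : set K) :
  conducive D -> overring V -> V <> setT -> overring W -> is_DVR W -> V `<=` W.
Proof.
move=> Dc Vov VT Wov Wdvr x Vx.
have [c c0 cV] := conductor_neq0 (Dc V Vov VT).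
apply: (DVR_completely_integrally_closed Wdvr c0) => n.
case: Wov => h _; apply/h/cV; elim: n => [|n IH]; first exact: overring1.
by rewrite exprS; apply: overringM.
Qed.

(** The only valuation overring V <> K is D': an element of V that is not integral
    would be avoided by a valuation overring W <> K, but V lies in W. *)
Lemma b_noetherian_integral_closure_DVR :
  conducive D -> ~ GRing.field_axiom D -> b_noetherian D ->
  is_DVR (integral_closure D).
Proof.
move=> Dc Dnf Db.
have [d d0 dN] : exists2 d : D, d != 0 & d \isn't a GRing.unit.
  apply: contrapT => no; apply: Dnf => d d0.
  by apply: contrapT => /negP dN; apply: no; exists d.
have [V Vval Vd] := valuation_overring_avoiding (inv_nonunit_not_integral d0 dN).
have VT : V <> setT by move=> VT; apply: Vd; rewrite VT.
suff -> : integral_closure D = V by apply: valuation_overring_DVR.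
apply/seteqP; split; first exact: integral_closure_sub_valuation_overring.
move=> x Vx; apply: contrapT => /valuation_overring_avoiding[W Wval Wx].
apply: (Wx); move: Vx; apply: proper_overring_sub_DVR => //; try by [case: Vval|case: Wval].
by apply: valuation_overring_DVR => // WT; apply: Wx; rewrite WT.
Qed.

Lemma integral_closure_DVR_b_noetherian :
  is_DVR (integral_closure D) -> b_noetherian D.
Proof.
move=> dvr; have [v vdv DE] := dvr.
have Vval : valuation_overring (integral_closure D).
  by split; [apply: integral_closure_overring|apply: DVR_valuation].
have DV (x : K) : base D x -> x != 0 -> 0 <= v x.
  move=> Dx x0; have := integral_closure_overring.1 _ Dx.
  by rewrite DE => -[/eqP|[]//]; rewrite (negPf x0).
(* For every valuation overring W, x = i (x / i) with x / i in D', hence in W. *)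
have mem (I : set K) (i x : K) : quasi_b_ideal I -> I i -> i != 0 ->
    base D x -> x != 0 -> v i <= v x -> I x.
  move=> [_ IE] iI i0 Dx x0 ix; rewrite -IE; split=> // W Wval.
  exists 1%N, (fun=> i), (fun=> x / i); split=> // [_|]; last first.
    by rewrite big_ord1 mulrC mulfVK.
  apply: integral_closure_sub_valuation_overring => //; rewrite DE; right.
  by rewrite mulf_neq0 ?invr_eq0 // valM ?invr_eq0 // valV // subr_ge0.
move=> I Iq Imono.
have sub n m : (n <= m)%N -> I n `<=` I m.
  by move=> /subnK <-; elim: (m - n)%N => //= k IH x /IH; apply: Imono.
(* The values attained on the union of the chain; the least one is attained at
   some y in I N, and the chain is constant from N on. *)
pose P k := `[< exists n, exists x, [/\ I n x, x != 0 & v x = k%:Z] >].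
have exP : exists k, P k.
  have [[[I0 _] ID IN] _] := Iq 0%N.
  have [x Ix x0] : exists2 x, I 0%N x & x != 0.
    apply: contrapT => no; apply: IN; apply/seteqP; split=> [x Ix|_ -> //] /=.
    by apply: contrapT => /eqP x0; apply: no; exists x.
  have := DV x (ID _ Ix) x0; case E: (v x) => [k|//] _.
  by exists k; apply/asboolP; exists 0%N, x.
case: (ex_minnP exP) => k /asboolP[N [y [Iy y0 vy]]] kmin.
exists N => n Nn; apply/seteqP; split; last exact: sub.
move=> x Ix; have [[[IN0 _] _ _] _] := Iq N.
have [->//|x0] := eqVneq x 0.
have [[_ ID _] _] := Iq n.
apply: (mem _ y) => //; first exact: ID.
have := DV x (ID _ Ix) x0; case E: (v x) => [j|//] _.
by rewrite vy lez_nat; apply: kmin; apply/asboolP; exists n, x.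
Qed.

End Overrings.

Theorem corollary22 (D : idomainType) (hcond : conducive D)
    (hnf : ~ GRing.field_axiom D) :
  (b_noetherian D <-> is_DVR (integral_closure D)) /\
  (integrally_closed D -> b_noetherian D -> is_DVR (base D)).
Proof.
split; last by move=> <-; apply: b_noetherian_integral_closure_DVR.
split; first exact: b_noetherian_integral_closure_DVR.
exact: integral_closure_DVR_b_noetherian.
Qed.
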